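(* Let $M,\rho,l,k,T_0,Q,\alpha,\omega>0$. Put $\Omega_L=\sqrt{k/M}$, $\Omega_T=\frac{\pi}{2l}\sqrt{T_0/\rho}$, $\omega_L=\omega/\Omega_L$, $\omega_T=\omega/\Omega_T$, and assume $\omega_L\ne 1$. Let $$\varkappa=\frac{\pi^2Q}{4\alpha\omega l^2(1-\omega_L^2)},\qquad \gamma=-\varkappa\Big(1-\sqrt{1-\tfrac1{\varkappa^2}}\Big),$$ and assume $\varkappa^2\ge1$ and $\frac{Q}{2kl}\sqrt{1-\frac1{\varkappa^2}}+\frac{T_0}{kl}\big(1-\frac{\omega_T^2}{4}\big)(1-\omega_L^2)\ge 0$. Set $$A=\pm\frac{8l}{\pi\omega_L\sqrt{1+\gamma^2}}\sqrt{\frac{Q}{2kl}\sqrt{1-\frac1{\varkappa^2}}+\frac{T_0}{kl}\Big(1-\frac{\omega_T^2}{4}\Big)(1-\omega_L^2)},\qquad B=\gamma A$$ (either sign). Then the functions $$w(t)=A\cos\frac{\omega t}{2}+B\sin\frac{\omega t}{2},$$ $$u(t)=-\frac{\pi^2}{32l}(A^2+B^2)+\frac{1}{1-\omega_L^2}\Big[\Big(\frac Qk-\frac{\pi^2}{32l}(A^2-B^2)\Big)\cos\omega t-\frac{\pi^2}{16l}AB\sin\omega t\Big]$$ satisfy the main-harmonic balance equations, as defined in the context, and the corresponding variable part of the tensile force, $T_1=k\big(u+\frac{\pi^2}{16l}w^2\big)$, is $$T_1(t)=\frac1{1-\omega_L^2}\Big[\Big(Q-\frac{\pi^2k\omega_L^2}{32l}(A^2-B^2)\Big)\cos\omega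 t-\frac{\pi^2k\omega_L^2}{16l}AB\sin\omega t\Big].$$
   Context: Consider the nonlinear system $M\ddot u+T_1(t)=Q\cos\omega t$ and $\rho\ddot w+\alpha\dot w+\frac{\pi^2}{4l^2}(T_0+T_1(t))w=0$, with $T_1(t)=k\big(u(t)+\frac{\pi^2}{16l}w(t)^2\big)$. It models two masses $M$ connected by an elastic string (length $2l$, linear density $\rho$, stiffness $k/2$, initial tension $T_0$); $u$ is the longitudinal displacement of the masses, $w$ the transverse displacement of the string midpoint, $\alpha$ the transverse viscosity, and $Q,\omega$ the amplitude and frequency of the external force. Main-harmonic balance equations: for $w(t)=A\cos\frac{\omega t}{2}+B\sin\frac{\omega t}{2}$ and $u(t)$ of the form $c_0+c_1\cos\omega t+c_2\sin\omega t$, one requires that (i) the first equation holds identically in $t$, and (ii) the second equation holds on average with weights $\cos\frac{\omega t}{2}$ and $\sin\frac{\omega t}{2}$, i.e. $$\int_0^{4\pi/\omega}\Big[\rho\ddot w+\alpha\dot w+\frac{\pi^2}{4l^2}(T_0+T_1)w\Big]g(t)\,dt=0\quad\text{for } g(t)=\cos\frac{\omega t}{2}\text{ and }g(t)=\sin\frac{\omega t}{2}.$$ *)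

(* Defs.v *)
From Stdlib Require Import Reals.
From Coquelicot Require Import Coquelicot.
Open Scope R_scope.

(** Variable part [T_1] of the tensile force of the string. *)
Definition tension (k l : R) (u w : R -> R) (t : R) : R :=
  k * (u t + PI ^ 2 / (16 * l) * w t ^ 2).

(** Left-hand side of the transverse equation. *)
Definition transverse_residual (rho alpha l k T0 : R) (u w : R -> R) (t : R) : R :=
  rho * Derive_n w 2 t + alpha * Derive w t
  + PI ^ 2 / (4 * l ^ 2) * (T0 + tension k l u w t) * w t.

(** The first two conjuncts make [u] and [w] trigonometric polynomials, so
    [Derive] and [Derive_n] below are genuine derivatives. [is_RInt _ 0 b 0]
    states that the integral exists and vanishes. *)
Definition main_harmonic_balance
    (M rho alpha l k T0 Q omega : R) (u w : R -> R) : Prop :=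
  (exists A B : R, forall t : R,
     w t = A * cos (omega * t / 2) + B * sin (omega * t / 2)) /\
  (exists c0 c1 c2 : R, forall t : R,
     u t = c0 + c1 * cos (omega * t) + c2 * sin (omega * t)) /\
  (forall t : R,
     M * Derive_n u 2 t + tension k l u w t = Q * cos (omega * t)) /\
  is_RInt (fun t => transverse_residual rho alpha l k T0 u w t * cos (omega * t / 2))
    0 (4 * PI / omega) 0 /\
  is_RInt (fun t => transverse_residual rho alpha l k T0 u w t * sin (omega * t / 2))
    0 (4 * PI / omega) 0.

(* Main.v *)
Require Import Defs.
From Stdlib Require Import Reals Lra.
From Coquelicot Require Import Coquelicot.
Open Scope R_scope.

(** With [theta = omega t / 2], inserting [w] and [T_1] into the transverse
    equation leaves a combination of the harmonics [theta] and [3 theta]. The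
    latter are orthogonal to [cos theta] and [sin theta], so the balance
    conditions say that the coefficients of [cos theta] and [sin theta] vanish.
    Put [r = sqrt (1 - 1 / kappa^2)] and [B = gamma A]. Compatibility of
    the two coefficient equations is [gamma^2 + 2 kappa gamma + 1 = 0], and then
    either of them fixes [A^2 (1 + gamma^2)] through
    [kappa + gamma = kappa r]. *)

(** The summand [0] keeps the derivative in the shape of the original function, so that the same
    rewriting yields the second derivative. *)
Lemma Derive_trig1 (a b c nu t : R) :
  Derive (fun t => a + b * cos (nu * t) + c * sin (nu * t)) t
  = 0 + (nu * c) * cos (nu * t) + (- (nu * b)) * sin (nu * t).
Proof. apply is_derive_unique; auto_derive; [easy | ring]. Qed.

Lemma Derive_n_trig1 (a b c nu t : R) :
  Derive_n (fun t => a + b * cos (nu * t) + c * sin (nu * t)) 2 t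
  = - nu ^ 2 * (b * cos (nu * t) + c * sin (nu * t)).
Proof.
  etransitivity; [exact (Derive_ext _ _ t (Derive_trig1 a b c nu)) | ].
  rewrite Derive_trig1. ring.
Qed.

(** The integrand has no constant term and the interval spans two periods of [cos (omega * t)], so
    an explicit periodic antiderivative takes equal values at both ends. *)
Lemma is_RInt_trig_poly_zero (omega c2 s2 c4 s4 : R) :
  omega <> 0 ->
  is_RInt (fun t => c2 * cos (omega * t) + s2 * sin (omega * t)
                    + c4 * cos (2 * (omega * t)) + s4 * sin (2 * (omega * t)))
    0 (4 * PI / omega) 0.
Proof.
  intros Hw.
  set (F := fun t => (c2 * sin (omega * t) - s2 * cos (omega * t)
     + c4 / 2 * sin (2 * (omega * t)) - s4 / 2 * cos (2 * (omega * t))) / omega).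
  assert (HF : minus (F (4 * PI / omega)) (F 0) = 0).
  { unfold F, minus, plus, opp; simpl.
    (* The arguments are put in the form expected by [cos_period] and [sin_period]: two periods for
       [omega * t], four for its double. *)
    replace (omega * (4 * PI / omega)) with (0 + 2 * INR 2 * PI) by (simpl; field; easy).
    replace (2 * (0 + 2 * INR 2 * PI)) with (0 + 2 * INR 4 * PI) by (simpl; ring).
    rewrite !cos_period, !sin_period, !Rmult_0_r. ring. }
  refine (eq_ind _ (is_RInt _ 0 _) _ _ HF).
  apply (is_RInt_derive (V := R_CompleteNormedModule) F).
  - intros t _. unfold F. auto_derive; [easy | field; easy].
  - intros t _. apply (ex_derive_continuous (V := R_NormedModule)).
    auto_derive; easy.
Qed.

Lemma cos_sin_double (omega t : R) :
  cos (omega * t) = 2 * cos (omega * t / 2) ^ 2 - 1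
  /\ sin (omega * t) = 2 * sin (omega * t / 2) * cos (omega * t / 2).
Proof.
  replace (omega * t) with (2 * (omega * t / 2)) at 1 3 by field.
  rewrite cos_2a_cos, sin_2a. split; ring.
Qed.

Lemma sin_sq (x : R) : sin x ^ 2 = 1 - cos x ^ 2.
Proof. generalize (sin2_cos2 x). unfold Rsqr. lra. Qed.

(** By the product-to-sum formulas, multiplying harmonic [3 theta] by harmonic [theta] produces only
    [2 theta = omega t] and [4 theta = 2 omega t], with no mean value. *)
Lemma is_RInt_third_harmonic_zero (omega E F : R) (f : R -> R) :
  omega <> 0 ->
  (forall t, f t = E * cos (3 * (omega * t / 2)) + F * sin (3 * (omega * t / 2))) ->
  is_RInt (fun t => f t * cos (omega * t / 2)) 0 (4 * PI / omega) 0 /\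
  is_RInt (fun t => f t * sin (omega * t / 2)) 0 (4 * PI / omega) 0.
Proof.
  intros Hw Hf. split.
  - apply is_RInt_ext with (2 := is_RInt_trig_poly_zero omega (E / 2) (F / 2) (E / 2) (F / 2) Hw).
    intros t _. rewrite Hf.
    replace (2 * (omega * t)) with (3 * (omega * t / 2) + omega * t / 2) by field.
    replace (omega * t) with (3 * (omega * t / 2) - omega * t / 2) at 1 2 by field.
    rewrite cos_plus, sin_plus, cos_minus, sin_minus.
    (* retypes the equation, stated in a [NormedModule] carrier, as one over [R] *)
    apply Rminus_diag_uniq. field.
  - apply is_RInt_ext with (2 := is_RInt_trig_poly_zero omega (F / 2) (- E / 2) (- F / 2) (E / 2) Hw).
    intros t _. rewrite Hf.
    replace (2 * (omega * t)) with (3 * (omega * t / 2) + omega * t / 2) by field.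
    replace (omega * t) with (3 * (omega * t / 2) - omega * t / 2) at 1 2 by field.
    rewrite cos_plus, sin_plus, cos_minus, sin_minus.
    apply Rminus_diag_uniq. field.
Qed.

Lemma transverse_residual_third_harmonic
    (rho alpha l k T0 omega A B P S : R) (u w : R -> R) :
  (forall t, w t = A * cos (omega * t / 2) + B * sin (omega * t / 2)) ->
  (forall t, tension k l u w t = P * cos (omega * t) + S * sin (omega * t)) ->
  let p := PI ^ 2 / (4 * l ^ 2) in
  - rho * omega ^ 2 / 4 * A + alpha * omega / 2 * B
    + p * (T0 * A + (P * A + S * B) / 2) = 0 ->
  - rho * omega ^ 2 / 4 * B - alpha * omega / 2 * A
    + p * (T0 * B + (S * A - P * B) / 2) = 0 ->
  forall t, transverse_residual rho alpha l k T0 u w t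
    = p * (P * A - S * B) / 2 * cos (3 * (omega * t / 2))
      + p * (P * B + S * A) / 2 * sin (3 * (omega * t / 2)).
Proof.
  intros Hw HT p Hc Hs t.
  assert (Hw' : forall t, w t = 0 + A * cos (omega / 2 * t) + B * sin (omega / 2 * t)).
  { intros x. rewrite Hw. replace (omega / 2 * x) with (omega * x / 2) by field. ring. }
  unfold transverse_residual. fold p.
  rewrite (Derive_n_ext _ _ 2 t Hw'), (Derive_ext _ _ t Hw').
  rewrite Derive_n_trig1, Derive_trig1, Hw, HT.
  replace (omega / 2 * t) with (omega * t / 2) by field.
  replace (3 * (omega * t / 2)) with (omega * t + omega * t / 2) by field.
  rewrite cos_plus, sin_plus.
  destruct (cos_sin_double omega t) as [-> ->].
  generalize (sin_sq (omega * t / 2)).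
  set (c := cos (omega * t / 2)). set (s := sin (omega * t / 2)). intros H.
  apply Rminus_diag_uniq.
  (* The identity holds only modulo [s ^ 2 = 1 - c ^ 2]; the last summand is the exact multiple of
     that relation which makes it polynomial. *)
  transitivity
    ((- rho * omega ^ 2 / 4 * A + alpha * omega / 2 * B
      + p * (T0 * A + (P * A + S * B) / 2)) * c
     + (- rho * omega ^ 2 / 4 * B - alpha * omega / 2 * A
      + p * (T0 * B + (S * A - P * B) / 2)) * s
     + p * c * (P * A + S * B) * (s ^ 2 - (1 - c ^ 2))).
  { field. }
  rewrite Hc, Hs, H. ring.
Qed.

(** The constant term of [u] cancels the mean of [w ^ 2]; in the harmonics,
    [1 - 1 / D = - (1 - D) / D] produces the factor [1 - D], which is [omegaL ^ 2] in the
    application. *)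
Lemma tension_trig (k l A B D omega Q t : R) (u w : R -> R) :
  k <> 0 -> l <> 0 -> D <> 0 ->
  (forall t, w t = A * cos (omega * t / 2) + B * sin (omega * t / 2)) ->
  (forall t, u t = - (PI ^ 2 / (32 * l)) * (A ^ 2 + B ^ 2)
      + 1 / D *
        ((Q / k - PI ^ 2 / (32 * l) * (A ^ 2 - B ^ 2)) * cos (omega * t)
         - PI ^ 2 / (16 * l) * A * B * sin (omega * t))) ->
  tension k l u w t =
    1 / D * ((Q - PI ^ 2 * k * (1 - D) / (32 * l) * (A ^ 2 - B ^ 2)) * cos (omega * t)
        - PI ^ 2 * k * (1 - D) / (16 * l) * A * B * sin (omega * t)).
Proof.
  intros Hk Hl HD Hw Hu. unfold tension. rewrite Hw, Hu.
  destruct (cos_sin_double omega t) as [-> ->].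
  generalize (sin_sq (omega * t / 2)).
  set (c := cos (omega * t / 2)). set (s := sin (omega * t / 2)). intros H.
  replace ((A * c + B * s) ^ 2) with (A ^ 2 * c ^ 2 + 2 * A * B * s * c + B ^ 2 * s ^ 2) by ring.
  rewrite H. field. auto.
Qed.

Theorem mainTheorem2 :
  forall M rho l k T0 Q alpha omega : R,
    0 < M -> 0 < rho -> 0 < l -> 0 < k -> 0 < T0 -> 0 < Q -> 0 < alpha -> 0 < omega ->
    let OmegaL := sqrt (k / M) in
    let OmegaT := PI / (2 * l) * sqrt (T0 / rho) in
    let omegaL := omega / OmegaL in
    let omegaT := omega / OmegaT in
    omegaL <> 1 ->
    let kappa := PI ^ 2 * Q / (4 * alpha * omega * l ^ 2 * (1 - omegaL ^ 2)) in
    let gamma := - kappa * (1 - sqrt (1 - 1 / kappa ^ 2)) in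
    let radicand :=
      Q / (2 * k * l) * sqrt (1 - 1 / kappa ^ 2)
      + T0 / (k * l) * (1 - omegaT ^ 2 / 4) * (1 - omegaL ^ 2) in
    1 <= kappa ^ 2 ->
    0 <= radicand ->
    forall sign : R, sign = 1 \/ sign = -1 ->
    let A := sign * (8 * l / (PI * omegaL * sqrt (1 + gamma ^ 2)) * sqrt radicand) in
    let B := gamma * A in
    let w := fun t : R => A * cos (omega * t / 2) + B * sin (omega * t / 2) in
    let u := fun t : R =>
      - (PI ^ 2 / (32 * l)) * (A ^ 2 + B ^ 2)
      + 1 / (1 - omegaL ^ 2) *
        ((Q / k - PI ^ 2 / (32 * l) * (A ^ 2 - B ^ 2)) * cos (omega * t)
         - PI ^ 2 / (16 * l) * A * B * sin (omega * t)) in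
    main_harmonic_balance M rho alpha l k T0 Q omega u w /\
    (forall t : R,
       tension k l u w t =
       1 / (1 - omegaL ^ 2) *
       ((Q - PI ^ 2 * k * omegaL ^ 2 / (32 * l) * (A ^ 2 - B ^ 2)) * cos (omega * t)
        - PI ^ 2 * k * omegaL ^ 2 / (16 * l) * A * B * sin (omega * t))).
Proof.
  intros M rho l k T0 Q alpha omega HM Hrho Hl Hk HT0 HQ Hal Hom OmegaL OmegaT
    omegaL omegaT HL1 kappa gamma radicand Hkap Hrad sign Hsign A B w u.
  assert (HPI : PI <> 0) by apply PI_neq0.
  assert (HOL : 0 < OmegaL) by (apply sqrt_lt_R0, Rdiv_lt_0_compat; assumption).
  assert (HoL : 0 < omegaL) by (apply Rdiv_lt_0_compat; assumption).
  assert (HoL2 : omegaL ^ 2 = omega ^ 2 * M / k).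
  { unfold omegaL. transitivity (omega ^ 2 / OmegaL ^ 2); [field; lra | ].
    unfold OmegaL. rewrite pow2_sqrt by (left; apply Rdiv_lt_0_compat; assumption).
    field; lra. }
  assert (HoT2 : omegaT ^ 2 = 4 * omega ^ 2 * l ^ 2 * rho / (PI ^ 2 * T0)).
  { assert (Hr : 0 < T0 / rho) by (apply Rdiv_lt_0_compat; assumption).
    assert (Hs : sqrt (T0 / rho) <> 0) by (apply Rgt_not_eq, sqrt_lt_R0, Hr).
    unfold omegaT, OmegaT.
    transitivity (4 * omega ^ 2 * l ^ 2 / (PI ^ 2 * sqrt (T0 / rho) ^ 2)).
    - field; repeat split; lra.
    - rewrite pow2_sqrt by lra. field; repeat split; lra. }
  set (D := 1 - omegaL ^ 2) in *.
  assert (HD : D <> 0).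
  { unfold D. intros H. apply HL1. nra. }
  set (r := sqrt (1 - 1 / kappa ^ 2)) in *.
  assert (Hkap0 : kappa <> 0) by nra.
  (* Here [1 <= kappa ^ 2] makes the square root genuine. *)
  assert (Hr2 : r ^ 2 = 1 - 1 / kappa ^ 2).
  { apply pow2_sqrt. assert (1 / kappa ^ 2 <= 1); [ | lra].
    apply Rcomplements.Rle_div_l; lra. }
  (* This is the square of [gamma + kappa = kappa * r]. *)
  assert (Hgam : gamma ^ 2 + 2 * kappa * gamma + 1 = 0).
  { unfold gamma. transitivity (kappa ^ 2 * r ^ 2 - kappa ^ 2 + 1); [ring | ].
    rewrite Hr2. field. assumption. }
  assert (HA2 : A ^ 2 * (1 + gamma ^ 2) = 64 * l ^ 2 / (PI ^ 2 * omegaL ^ 2) * radicand).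
  { assert (Hg : 0 < 1 + gamma ^ 2) by nra.
    assert (Hg' : sqrt (1 + gamma ^ 2) <> 0) by (apply Rgt_not_eq, sqrt_lt_R0, Hg).
    assert (Hsg : sign ^ 2 = 1) by (destruct Hsign as [-> | ->]; ring).
    unfold A.
    transitivity (sign ^ 2 * 64 * l ^ 2 / (PI ^ 2 * omegaL ^ 2)
      * ((1 + gamma ^ 2) / sqrt (1 + gamma ^ 2) ^ 2) * sqrt radicand ^ 2).
    - field; repeat split; lra.
    - rewrite !pow2_sqrt by lra. rewrite Hsg. field; repeat split; lra. }
  assert (HT : forall t, tension k l u w t =
       1 / D * ((Q - PI ^ 2 * k * omegaL ^ 2 / (32 * l) * (A ^ 2 - B ^ 2)) * cos (omega * t)
        - PI ^ 2 * k * omegaL ^ 2 / (16 * l) * A * B * sin (omega * t))).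
  { intros t. replace (omegaL ^ 2) with (1 - D) by (unfold D; ring).
    apply tension_trig; auto; lra. }
  split; [ | exact HT].
  set (P := 1 / D * (Q - PI ^ 2 * k * omegaL ^ 2 / (32 * l) * (A ^ 2 - B ^ 2))).
  set (S := - (1 / D * (PI ^ 2 * k * omegaL ^ 2 / (16 * l) * A * B))).
  assert (HT' : forall t, tension k l u w t = P * cos (omega * t) + S * sin (omega * t)).
  { intros t. rewrite HT. unfold P, S. ring. }
  set (p := PI ^ 2 / (4 * l ^ 2)).
  (* In [P * A + S * B] and [S * A - P * B] the cubic terms are [A] and [B] times the same multiple
     of [A ^ 2 + B ^ 2], while the [Q] terms have opposite signs. [X] collects what acts equally on
     both coefficients. *)
  set (X := p * T0 - rho * omega ^ 2 / 4
            - p * (PI ^ 2 * k * omegaL ^ 2 / (32 * l) * (A ^ 2 * (1 + gamma ^ 2))) / (2 * D)).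
  (* Thus [kappa] is the ratio of parametric forcing to damping. *)
  assert (Hq : p * Q / (2 * D) = alpha * omega / 2 * kappa).
  { unfold p, kappa. field. repeat split; lra. }
  (* Since [p * T0 * omegaT ^ 2 = rho * omega ^ 2], the [T0] part of [radicand] cancels the linear
     terms of [X], leaving only the part with [r]. *)
  assert (HX : X = - (alpha * omega / 2) * (kappa + gamma)).
  { transitivity (- (p * Q / (2 * D)) * r).
    - unfold X. rewrite HA2. unfold radicand, p. rewrite HoT2. field. repeat split; lra.
    - rewrite Hq. unfold gamma. ring. }
  assert (Hcos : - rho * omega ^ 2 / 4 * A + alpha * omega / 2 * B
    + p * (T0 * A + (P * A + S * B) / 2) = 0).
  { transitivity (A * (X + p * Q / (2 * D) + alpha * omega / 2 * gamma)).
    - unfold X, P, S, B. field. split; lra.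
    - rewrite Hq, HX. ring. }
  assert (Hsin : - rho * omega ^ 2 / 4 * B - alpha * omega / 2 * A
    + p * (T0 * B + (S * A - P * B) / 2) = 0).
  { transitivity (A * (gamma * X - gamma * (p * Q / (2 * D)) - alpha * omega / 2)).
    - unfold X, P, S, B. field. split; lra.
    - rewrite Hq, HX.
      transitivity (- A * (alpha * omega / 2) * (gamma ^ 2 + 2 * kappa * gamma + 1)); [ring | ].
      rewrite Hgam. ring. }
  set (c0 := - (PI ^ 2 / (32 * l)) * (A ^ 2 + B ^ 2)).
  set (c1 := 1 / D * (Q / k - PI ^ 2 / (32 * l) * (A ^ 2 - B ^ 2))).
  set (c2 := - (1 / D * (PI ^ 2 / (16 * l) * A * B))).
  assert (Hu : forall t, u t = c0 + c1 * cos (omega * t) + c2 * sin (omega * t)).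
  { intros t. unfold u, c0, c1, c2. ring. }
  split; [exists A, B; reflexivity | ].
  split; [exists c0, c1, c2; exact Hu | ].
  split.
  - intros t. rewrite (Derive_n_ext _ _ 2 t Hu), Derive_n_trig1, HT.
    (* With this the inertia term cancels the terms quadratic in [A], [B] in the tension and reduces
       [Q / D] to [Q]. *)
    assert (HMo : M * omega ^ 2 = k * (1 - D)) by (unfold D; rewrite HoL2; field; lra).
    replace (omegaL ^ 2) with (1 - D) by (unfold D; ring).
    transitivity (- (M * omega ^ 2) * (c1 * cos (omega * t) + c2 * sin (omega * t))
      + 1 / D * ((Q - PI ^ 2 * k * (1 - D) / (32 * l) * (A ^ 2 - B ^ 2)) * cos (omega * t)
        - PI ^ 2 * k * (1 - D) / (16 * l) * A * B * sin (omega * t))); [ring | ].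
    rewrite HMo. unfold c1, c2. field. repeat split; lra.
  - apply (is_RInt_third_harmonic_zero omega
      (p * (P * A - S * B) / 2) (p * (P * B + S * A) / 2)); [lra | ].
    apply transverse_residual_third_harmonic; auto.
Qed.
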